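(* Let $\alpha\in\omega+1$ and $T_{\alpha}=\mathrm{Th}(\mathfrak{M}_{\alpha})$. Then $T_{\alpha}$ admits quantifier elimination down to closure formulas: every $\mathcal{L}$-formula is equivalent modulo $T_{\alpha}$ to a closure formula.
   Context: $\mathcal{L}$ is the language with a single binary relation $R$, interpreted as a symmetric, anti-reflexive (graph) relation. For a finite graph $A$, the predimension is $\delta(A)=|A|-|R[A]|$, where $|R[A]|$ is the number of edges of $A$. $\mathcal{K}_{\omega}$ is the class of finite graphs $A$ with $\delta(B)>0$ for every non-empty $B\subseteq A$ (equivalently, finite acyclic graphs). For $n\geq 1$, $\mathcal{K}_{n}$ is the class of members of $\mathcal{K}_{\omega}$ in which every vertex $x$ of degree $\geq n+2$ is not the starting point of a path $x,y_1,\dots,y_{2n}$ of distinct vertices (a path of length $2n+1$ starting at $x$). $\mathcal{K}_{0}$ is the class of members of $\mathcal{K}_{\omega}$ all of whose vertices have degree $\leq 3$. All classes contain the empty graph. For finite $A\subseteq B$, $A$ is closed in $B$ (written $A\leq^{*}B$) if $\delta(C)>\delta(A)$ for every $C$ with $A\subsetneq C\subseteq B$; for a possibly infinite $M$, $A\leq^{*}M$ means $A\leq^{*}B$ for all finite $B$ with $A\subseteq B\subseteq M$. $B$ is an intrinsic extension of $A$ if $A\subseteq B$ and no proper substructure of $B$ containing $A$ is closed in $B$. The class $\langle\mathcal{K}_{\alpha},\leq^{*}\rangle$ has full (free) amalgamation, and $\mathfrak{M}_{\alpha}$ denotes its unique countable generic (Hrushovski–Fraïssé limit). For $\bar{a}\cong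 A$, $\mathrm{diag}_{A}(\bar{x})$ is the atomic diagram of $A$, and $\mathrm{diag}_{(A,B)}(\bar{x},\bar{y})$ is the atomic diagram of $B$ with $\bar{x}$ enumerating $A$ and $\bar{y}$ enumerating $B\setminus A$. The set of closure formulas is the least class of $\mathcal{L}$-formulas such that: (i) $\mathrm{diag}_{A}(\bar{x})$ is a closure formula for each $A\in\mathcal{K}_{\alpha}$; (ii) if $\varphi_{AB}(\bar{x}\bar{y})$ is a closure formula and $B\in\mathcal{K}_{\alpha}$ is an intrinsic extension of $A$, then $\exists\bar{y}[\mathrm{diag}_{(A,B)}(\bar{x},\bar{y})\wedge\varphi_{AB}(\bar{x}\bar{y})]$ is a closure formula; (iii) under the same conditions, $\forall\bar{y}[\mathrm{diag}_{(A,B)}(\bar{x},\bar{y})\rightarrow\varphi_{AB}(\bar{x}\bar{y})]$ is a closure formula; (iv) Boolean combinations of closure formulas are closure formulas. (So closure formulas are those whose quantifiers are relativized to closures.) *)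

(* Defs.v *)
From HB Require Import structures.
From mathcomp Require Import all_boot all_order all_algebra.

Set Implicit Arguments.
Unset Strict Implicit.
Unset Printing Implicit Defensive.

Import Order.TTheory GRing.Theory Num.Theory.

(* The carrier may be empty, so that finite graphs coerce to structures; an
   empty structure has no assignments and never affects [entails] below. *)
Record structure := Structure {
  carrier :> Type;
  Rel : carrier -> carrier -> Prop
}.

Record fgraph := FGraph {
  vertex :> finType;
  edge : rel vertex;
  edge_sym : symmetric edge;
  edge_irr : irreflexive edge
}.
Arguments edge {f}.

Definition structure_of_fgraph (G : fgraph) : structure :=
  @Structure G (fun u v => edge u v).

(* Finite substructures of M are represented by embeddings of finite graphs. *)
Definition embedding (M N : structure) (f : M -> N) : Prop :=
  injective f /\ forall u v, Rel u v <-> Rel (f u) (f v).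

Definition fembedding (G : fgraph) (M : structure) (f : G -> M) : Prop :=
  @embedding (structure_of_fgraph G) M f.

Definition edges (G : fgraph) (A : {set G}) : {set {set G}} :=
  [set [set u; v] | u in A, v in A & edge u v].

Definition delta (G : fgraph) (A : {set G}) : int :=
  (#|A|%:Z - #|edges A|%:Z)%R.

Definition closed_in (G : fgraph) (A : {set G}) : Prop :=
  forall C : {set G}, A \proper C -> (delta A < delta C)%R.

Definition intrinsic (G : fgraph) (A : {set G}) : Prop :=
  forall C : {set G}, A \subset C -> C \proper [set: G] -> ~ closed_in C.

Definition degree (G : fgraph) (x : G) : nat := #|[set y | edge x y]|.

Definition starts_path (G : fgraph) (x : G) (k : nat) : Prop :=
  exists p : seq G, [/\ size p = k, path edge x p & uniq (x :: p)].

Definition K_omega (G : fgraph) : Prop :=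
  forall B : {set G}, B != set0 -> (0 < delta B)%R.

(* An ordinal in omega + 1: [Some n] is n and [None] is omega. *)
Definition K (alpha : option nat) (G : fgraph) : Prop :=
  match alpha with
  | None => K_omega G
  | Some 0 => K_omega G /\ forall x : G, degree x <= 3
  | Some n => K_omega G /\
      forall x : G, n + 2 <= degree x -> ~ starts_path x (2 * n)
  end.

(* f identifies A with a finite substructure of M that is closed in every
   finite substructure B of M containing it; h is the inclusion of A in B. *)
Definition closed_embedding (A : fgraph) (M : structure) (f : A -> M) : Prop :=
  fembedding f /\
  forall (B : fgraph) (g : B -> M) (h : A -> B),
    fembedding g -> (forall a, g (h a) = f a) -> closed_in (h @: [set: A]).

Record generic (alpha : option nat) (M : structure) : Prop := Generic {
  generic_countable : exists c : M -> nat, injective c;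
  generic_closure : forall (k : nat) (s : 'I_k -> M),
    exists (A : fgraph) (f : A -> M),
      [/\ K alpha A, closed_embedding f &
          forall i, exists a, f a = s i];
  generic_extension : forall (A B : fgraph) (f : A -> M) (h : A -> B),
    closed_embedding f -> K alpha B ->
    @fembedding A (structure_of_fgraph B) h -> closed_in (h @: [set: A]) ->
    exists g : B -> M, closed_embedding g /\ forall a, g (h a) = f a
}.

Inductive formula : Type :=
| FTrue
| FEq of nat & nat
| FRel of nat & nat
| FNot of formula
| FAnd of formula & formula
| FOr of formula & formula
| FImp of formula & formula
| FEx of nat & formula
| FAll of nat & formula.

Fixpoint fv (phi : formula) : seq nat :=
  match phi with
  | FTrue => [::]
  | FEq i j | FRel i j => [:: i; j]
  | FNot p => fv p
  | FAnd p q | FOr p q | FImp p q => fv p ++ fv q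
  | FEx i p | FAll i p => [seq j <- fv p | j != i]
  end.

Definition update (T : Type) (env : nat -> T) (i : nat) (a : T) : nat -> T :=
  fun j => if j == i then a else env j.

Fixpoint sat (M : structure) (env : nat -> M) (phi : formula) : Prop :=
  match phi with
  | FTrue => True
  | FEq i j => env i = env j
  | FRel i j => Rel (env i) (env j)
  | FNot p => ~ sat env p
  | FAnd p q => sat env p /\ sat env q
  | FOr p q => sat env p \/ sat env q
  | FImp p q => sat env p -> sat env q
  | FEx i p => exists a, sat (update env i a) p
  | FAll i p => forall a, sat (update env i a) p
  end.

Definition holds (M : structure) (phi : formula) : Prop :=
  forall env : nat -> M, sat env phi.

Definition Th (M : structure) (phi : formula) : Prop :=
  fv phi = [::] /\ holds M phi.

Definition entails (T : formula -> Prop) (phi : formula) : Prop :=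
  forall N : structure, (forall s, T s -> holds N s) -> holds N phi.

Definition equiv_mod (T : formula -> Prop) (phi psi : formula) : Prop :=
  entails T (FAnd (FImp phi psi) (FImp psi phi)).

Definition FAnds (ps : seq formula) : formula := foldr FAnd FTrue ps.
Definition FExs (ys : seq nat) (phi : formula) : formula := foldr FEx phi ys.
Definition FAlls (ys : seq nat) (phi : formula) : formula := foldr FAll phi ys.

(* The atomic diagram of G, the vertex u being named by the variable x u. *)
Definition diag (G : fgraph) (x : G -> nat) : formula :=
  FAnds [seq FAnd
           (if u == v then FEq (x u) (x v) else FNot (FEq (x u) (x v)))
           (if edge u v then FRel (x u) (x v) else FNot (FRel (x u) (x v)))
        | u <- enum G, v <- enum G].

(* In the quantifier clauses x names the vertices of B, so that its restriction
   to A is the tuple of variables written x-bar and ys is y-bar; phi has no free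
   variables beyond these two tuples. *)
Inductive closure_formula (alpha : option nat) : formula -> Prop :=
| CF_diag (A : fgraph) (x : A -> nat) :
    K alpha A -> injective x -> closure_formula alpha (diag x)
| CF_ex (B : fgraph) (A : {set B}) (x : B -> nat) (ys : seq nat)
    (phi : formula) :
    K alpha B -> intrinsic A -> injective x ->
    perm_eq ys [seq x b | b in ~: A] -> {subset fv phi <= codom x} ->
    closure_formula alpha phi ->
    closure_formula alpha (FExs ys (FAnd (diag x) phi))
| CF_all (B : fgraph) (A : {set B}) (x : B -> nat) (ys : seq nat)
    (phi : formula) :
    K alpha B -> intrinsic A -> injective x ->
    perm_eq ys [seq x b | b in ~: A] -> {subset fv phi <= codom x} ->
    closure_formula alpha phi ->
    closure_formula alpha (FAlls ys (FImp (diag x) phi))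
| CF_not (phi : formula) :
    closure_formula alpha phi -> closure_formula alpha (FNot phi)
| CF_and (phi psi : formula) :
    closure_formula alpha phi -> closure_formula alpha psi ->
    closure_formula alpha (FAnd phi psi)
| CF_or (phi psi : formula) :
    closure_formula alpha phi -> closure_formula alpha psi ->
    closure_formula alpha (FOr phi psi)
| CF_imp (phi psi : formula) :
    closure_formula alpha phi -> closure_formula alpha psi ->
    closure_formula alpha (FImp phi psi).

(* Main.v *)
(* In a forest, A is closed in B iff no edge leaves A.  Hence the generic M is a
   disjoint union of finite trees, and every tree that occurs has a copy disjoint
   from any given finite part of M.  A witness for an existential quantifier is
   therefore either within a bounded distance of the parameters, where it is
   reached by moves to neighbours, or can be replaced by its copy in a component
   avoiding the parameters, as in Gaifman's locality theorem but with no
   sentences left over.  So the truth of a formula depends only on the game of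
   bounded length in which all moves go to neighbours.  Adding a neighbour z of
   a point is an intrinsic extension (delta does not increase), so such a game is
   described by finitely many closure formulas.  An equivalence that holds in M
   holds modulo Th(M). *)
Require Import Defs.
From HB Require Import structures.
From mathcomp Require Import all_boot all_order all_algebra.
From mathcomp Require Import boolp zify.
(* Restores [Defs.fgraph], which finfun shadows. *)
Import Defs.

Set Implicit Arguments.
Unset Strict Implicit.
Unset Printing Implicit Defensive.

Import Order.TTheory GRing.Theory Num.Theory.

(** * Finite graphs: embeddings, predimension and the classes [K alpha] *)

Section Graphs.

Definition gembedding (G H : fgraph) (h : G -> H) : Prop :=
  @fembedding G (structure_of_fgraph H) h.

(** For an embedding [h] this says that the image is a union of connected components. *)
Definition nbr_closed (G H : fgraph) (h : G -> H) : Prop :=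
  forall u y, edge (h u) y -> exists v, y = h v.

Lemma gembedding_edge (G H : fgraph) (h : G -> H) u v :
  gembedding h -> edge (h u) (h v) = edge u v.
Proof. by case=> _ e; apply/idP/idP => /e. Qed.

Lemma edgesP (G : fgraph) (A : {set G}) (e : {set G}) :
  reflect (exists u v, [/\ u \in A, v \in A, edge u v & e = [set u; v]])
          (e \in edges A).
Proof.
apply: (iffP imset2P) => [[u v uA]|[u [v [uA vA euv ->]]]].
  by rewrite inE => /andP[vA euv] ->; exists u, v.
by exists u v => //; rewrite inE vA.
Qed.

Lemma edges_imset (G H : fgraph) (h : G -> H) (S : {set G}) :
  gembedding h -> edges (h @: S) = [set h @: e | e : {set G} in edges S].
Proof.
move=> hemb; apply/setP => e; apply/edgesP/imsetP.
  move=> [u [v [/imsetP[a aS ->] /imsetP[b bS ->] ab ->]]].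
  exists [set a; b]; last by rewrite imsetU !imset_set1.
  by apply/edgesP; exists a, b; rewrite -(gembedding_edge _ _ hemb).
move=> [_ /edgesP[a [b [aS bS ab ->]]] ->]; exists (h a), (h b).
by rewrite !imset_f ?(gembedding_edge _ _ hemb) // imsetU !imset_set1.
Qed.

Lemma card_edges_imset (G H : fgraph) (h : G -> H) (S : {set G}) :
  gembedding h -> #|edges (h @: S)| = #|edges S|.
Proof.
move=> hemb; rewrite (edges_imset _ hemb) card_imset //.
by apply: imset_inj; case: hemb.
Qed.

Lemma delta_imset (G H : fgraph) (h : G -> H) (S : {set G}) :
  gembedding h -> delta (h @: S) = delta S.
Proof.
move=> hemb; rewrite /delta (card_edges_imset _ hemb) card_imset //.
by case: hemb.
Qed.

Lemma edges_sub (G : fgraph) (A B : {set G}) :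
  A \subset B -> edges A \subset edges B.
Proof.
move=> AB; apply/subsetP => e /edgesP[u [v [uA vA uv ->]]].
by apply/edgesP; exists u, v; rewrite !(subsetP AB).
Qed.

(** Adding [z] to [A] costs one vertex and gains at least the edge from [u] to [z], so [delta] does
    not increase. *)
Lemma edge_not_closed (G : fgraph) (A : {set G}) (u z : G) :
  u \in A -> z \notin A -> edge u z -> ~ closed_in A.
Proof.
move=> uA zA uz /(_ (z |: A)) cl.
have sA : A \subset z |: A by rewrite subsetUr.
have /cl : A \proper z |: A.
  by apply/properP; split=> //; exists z => //; rewrite setU11.
rewrite /delta cardsU1 zA ltNge => /negP; apply.
have : edges A \proper edges (z |: A).
  apply/properP; split; first exact: edges_sub.
  exists [set u; z].
    by apply/edgesP; exists u, z; rewrite setU11 !inE uA orbT.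
  apply/negP => /edgesP[a [b [aA bA _ /setP/(_ z)]]].
  rewrite !inE eqxx orbT => /esym/orP[]/eqP ze; by rewrite ze ?aA ?bA in zA.
by move/proper_card; lia.
Qed.

(** A proper subset containing every vertex but [z] must miss [z], and then the edge from [u] leaves
    it. *)
Lemma intrinsic_pendant (G : fgraph) (u z : G) :
  edge u z -> intrinsic [set x | x != z].
Proof.
move=> uz C AC /properP[_ [y _ yC]].
have yz : y = z.
  by apply/eqP/negPn/negP => nyz; rewrite (subsetP AC) ?inE // in yC.
rewrite yz in yC; apply: (edge_not_closed _ yC uz).
rewrite (subsetP AC) // inE; apply/eqP => e; by rewrite e edge_irr in uz.
Qed.

(** Beyond acyclicity, [K alpha] only restricts the degree and the paths at one vertex. It can thus
    be checked vertex by vertex, each time in a suitable member [H] of the class. *)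
Lemma K_transfer alpha (G : fgraph) :
  K_omega G ->
  (forall x : G, exists (H : fgraph) (y : H),
    [/\ K alpha H, degree x <= degree y &
        forall k, starts_path x k -> starts_path y k]) ->
  K alpha G.
Proof.
case: alpha => [[|n]|] // Gw loc; split=> // x;
  have [H [y [[_ KH] dxy pxy]]] := loc x; first exact: leq_trans (KH y).
by move=> dx /pxy; apply: KH; apply: leq_trans dxy.
Qed.

Lemma K_K_omega alpha (G : fgraph) : K alpha G -> K_omega G.
Proof. by case: alpha => [[|n]|] // []. Qed.

Lemma K_embedded alpha (G H : fgraph) (h : G -> H) :
  gembedding h -> K alpha H -> K alpha G.
Proof.
move=> hemb KH; have [hinj _] := hemb; apply: K_transfer => [S S0|x].
  rewrite -(delta_imset _ hemb); apply: (K_K_omega KH).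
  by apply: contra S0; rewrite imset_eq0.
exists H, (h x); split=> // [|k [p [sp pp up]]].
  rewrite /degree -(card_imset _ hinj); apply/subset_leq_card/subsetP => y.
  by case/imsetP=> z; rewrite !inE => xz ->; rewrite (gembedding_edge _ _ hemb).
exists (map h p); rewrite size_map -map_cons map_inj_uniq //; split=> //.
rewrite path_map; apply: sub_path pp => u v /=.
by rewrite (gembedding_edge _ _ hemb).
Qed.

Lemma nbr_closed_degree (G H : fgraph) (h : G -> H) x :
  gembedding h -> nbr_closed h -> degree (h x) <= degree x.
Proof.
move=> hemb cl; have [hinj _] := hemb.
rewrite /degree -(card_imset _ hinj); apply/subset_leq_card/subsetP => y.
rewrite inE => hy; have [v ev] := cl _ _ hy; subst y; apply: imset_f.
by rewrite inE -(gembedding_edge _ _ hemb).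
Qed.

(** A path that starts in the image never leaves it, so it lifts one vertex at a time. *)
Lemma nbr_closed_starts_path (G H : fgraph) (h : G -> H) x k :
  gembedding h -> nbr_closed h -> starts_path (h x) k -> starts_path x k.
Proof.
move=> hemb cl [p [sp pp up]]; have [hinj _] := hemb.
have [q [eq pq]] : exists q, p = map h q /\ path edge x q.
  elim: p x pp {sp up} => [|y p IH] x /=; first by exists [::].
  case/andP=> hy pp; have [v ev] := cl _ _ hy; subst y.
  have [q [-> pq]] := IH _ pp; exists (v :: q) => /=.
  by rewrite -(gembedding_edge _ _ hemb) hy.
exists q; split=> //; first by rewrite -sp eq size_map.
by rewrite -(map_inj_uniq hinj) /= -eq.
Qed.

(** * Disjoint sums, which serve as free amalgams over the empty graph *)

Definition sum_edge (G H : fgraph) (s t : G + H) : bool :=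
  match s, t with
  | inl u, inl v => edge u v
  | inr u, inr v => edge u v
  | _, _ => false
  end.

Lemma sum_edge_sym G H : symmetric (@sum_edge G H).
Proof. by move=> [u|u] [v|v] //=; rewrite edge_sym. Qed.

Lemma sum_edge_irr G H : irreflexive (@sum_edge G H).
Proof. by move=> [u|u] /=; rewrite edge_irr. Qed.

Definition sum_graph (G H : fgraph) : fgraph :=
  FGraph (@sum_edge_sym G H) (@sum_edge_irr G H).

Definition sum_inl (G H : fgraph) (u : G) : sum_graph G H := inl u.
Definition sum_inr (G H : fgraph) (u : H) : sum_graph G H := inr u.

Lemma sum_inl_emb G H : gembedding (@sum_inl G H).
Proof. by split=> [u v []|]. Qed.

Lemma sum_inr_emb G H : gembedding (@sum_inr G H).
Proof. by split=> [u v []|]. Qed.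

Lemma sum_inl_closed G H : nbr_closed (@sum_inl G H).
Proof. by move=> u [v|v] // _; exists v. Qed.

Lemma sum_inr_closed G H : nbr_closed (@sum_inr G H).
Proof. by move=> u [v|v] // _; exists v. Qed.

Lemma sum_setE (G H : fgraph) (S : {set sum_graph G H}) :
  S = (@sum_inl G H @: (@sum_inl G H @^-1: S)) :|:
      (@sum_inr G H @: (@sum_inr G H @^-1: S)).
Proof.
apply/setP => x; rewrite inE; apply/idP/orP => [|[] /imsetP[u + ->]].
- by case: x => u uS; [left|right]; apply/imsetP; exists u; rewrite ?inE.
- by rewrite inE.
- by rewrite inE.
Qed.

(** No edge joins the two summands, so every edge inside [S] lies in one of its two traces. *)
Lemma delta_sum (G H : fgraph) (S : {set sum_graph G H}) :
  (delta (@sum_inl G H @^-1: S) + delta (@sum_inr G H @^-1: S) <= delta S)%R.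
Proof.
set S1 := _ @^-1: S; set S2 := _ @^-1: S.
have cS : #|S| = #|S1| + #|S2|.
  rewrite [in LHS](sum_setE S) cardsU.
  have [[i1 _] [i2 _]] := (sum_inl_emb G H, sum_inr_emb G H).
  rewrite !card_imset // (_ : _ :&: _ = set0) ?cards0 ?subn0 //.
  by apply/setP => x; rewrite !inE; apply/andP => -[/imsetP[u _ ->] /imsetP[]].
have : #|edges S| <= #|edges S1| + #|edges S2|.
  rewrite -(card_edges_imset S1 (sum_inl_emb G H)).
  rewrite -(card_edges_imset S2 (sum_inr_emb G H)).
  apply: leq_trans (leq_card_setU _ _).
  apply/subset_leq_card/subsetP => e.
  case/edgesP => [u [v [uS vS uv ->]]].
  rewrite inE; apply/orP; case: u uS uv => u uS; case: v vS => v vS //= uv.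
    by left; apply/(@edgesP (sum_graph G H)); exists (inl u), (inl v); split=> //;
      apply/imsetP; [exists u | exists v] => //; rewrite inE.
  by right; apply/(@edgesP (sum_graph G H)); exists (inr u), (inr v); split=> //;
    apply/imsetP; [exists u | exists v] => //; rewrite inE.
rewrite /delta cS; lia.
Qed.

Lemma delta0 (G : fgraph) : delta (set0 : {set G}) = 0%R.
Proof.
rewrite /delta (_ : edges set0 = set0) ?cards0 //.
by apply/setP => e; rewrite inE; apply/edgesP => -[u [v []]]; rewrite inE.
Qed.

Lemma delta_ge0 (G : fgraph) (S : {set G}) : K_omega G -> (0 <= delta S)%R.
Proof.
by move=> KG; have [->|/KG/ltW//] := eqVneq S set0; rewrite delta0.
Qed.

Lemma K_sum alpha (G H : fgraph) :
  K alpha G -> K alpha H -> K alpha (sum_graph G H).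
Proof.
move=> KG KH; have [wG wH] := (K_K_omega KG, K_K_omega KH).
apply: K_transfer => [S S0|[u|u]].
- apply: lt_le_trans (delta_sum S).
  have [e1|n1] := eqVneq (@sum_inl G H @^-1: S) set0; last first.
    by rewrite ltr_wpDr ?delta_ge0 ?wG.
  rewrite e1 delta0 add0r wH //; apply: contra S0 => /eqP e2.
  by rewrite (sum_setE S) e1 e2 !imset0 setU0.
- exists G, u; split=> // [|k].
    exact: nbr_closed_degree (sum_inl_emb G H) (@sum_inl_closed G H).
  exact: nbr_closed_starts_path (sum_inl_emb G H) (@sum_inl_closed G H).
- exists H, u; split=> // [|k].
    exact: nbr_closed_degree (sum_inr_emb G H) (@sum_inr_closed G H).
  exact: nbr_closed_starts_path (sum_inr_emb G H) (@sum_inr_closed G H).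
Qed.

(** What a larger set adds to the left summand is a non-empty part of [H], of positive [delta]. *)
Lemma sum_inl_closed_in (G H : fgraph) :
  K_omega H -> closed_in (@sum_inl G H @: [set: G]).
Proof.
move=> wH C /properP[sC [y yC yG]].
apply: lt_le_trans (delta_sum C); rewrite (delta_imset _ (sum_inl_emb G H)).
have -> : @sum_inl G H @^-1: C = setT.
  by apply/setP => u; rewrite !inE (subsetP sC) ?imset_f.
rewrite ltrDl; apply: wH; case: y yC yG => y yC yG.
  by case/negP: yG; apply: imset_f.
by apply/set0Pn; exists y; rewrite inE.
Qed.

(** Symmetrizing and dropping loops turns any set of pairs into a graph. Graphs on [T] are thus
    indexed by a finite type, over which finite conjunctions can range. *)
Definition set_edge (T : finType) (E : {set T * T}) (u v : T) : bool :=
  (u != v) && (((u, v) \in E) || ((v, u) \in E)).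

Lemma set_edge_sym T E : symmetric (@set_edge T E).
Proof. by move=> u v; rewrite /set_edge eq_sym orbC. Qed.

Lemma set_edge_irr T E : irreflexive (@set_edge T E).
Proof. by move=> u; rewrite /set_edge eqxx. Qed.

Definition set_graph (T : finType) (E : {set T * T}) : fgraph :=
  FGraph (@set_edge_sym T E) (@set_edge_irr T E).

End Graphs.

(** * Finite substructures and neighbours in the generic structure *)

Section Generic.

Variables (alpha : option nat) (M : structure).
Hypothesis hM : generic alpha M.

Lemma closed_cover (T : finType) (s : T -> M) :
  exists (A : fgraph) (f : A -> M),
    [/\ K alpha A, closed_embedding f & forall t, exists a, f a = s t].
Proof.
have [A [f [KA cf sf]]] := generic_closure hM (fun i : 'I_#|T| => s (enum_val i)).
exists A, f; split=> // t; have [a ea] := sf (enum_rank t).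
by exists a; rewrite ea enum_rankK.
Qed.

Lemma Rel_sym (x y : M) : Rel x y -> Rel y x.
Proof.
have [A [f [_ [[_ fe] _] sf]]] := closed_cover (fun b : bool => if b then x else y).
have [[a ea] [b eb]] := (sf true, sf false); rewrite -ea -eb.
by move=> /fe/= ab; apply/fe; rewrite /= edge_sym.
Qed.

Lemma Rel_irr (x : M) : ~ Rel x x.
Proof.
have [A [f [_ [[_ fe] _] sf]]] := closed_cover (fun _ : unit => x).
by have [a <-] := sf tt; move=> /fe/=; rewrite edge_irr.
Qed.

(** A finite substructure of [M] embeds in a closed one from the class, and the class is
    hereditary. *)
Lemma K_induced (B : fgraph) (g : B -> M) : fembedding g -> K alpha B.
Proof.
move=> [ginj ge]; have [A [f [KA [[finj fe] _] /choice[h hf]]]] := closed_cover g.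
apply: (@K_embedded _ _ _ h) KA; split=> [u v e|u v].
  by apply: ginj; rewrite -!hf e.
by split=> [/ge|/fe]; rewrite ?hf => e; [apply/fe|apply/ge]; rewrite ?hf.
Qed.

Definition induced (T : finType) (g : T -> M) : fgraph :=
  set_graph [set p : T * T | `[< Rel (g p.1) (g p.2) >]].

Lemma induced_embedding (T : finType) (g : T -> M) :
  injective g -> @fembedding (induced g) M g.
Proof.
move=> ginj; split=> // u v; rewrite /= /set_edge !inE /=; split=> [|uv].
  by case/andP=> _ /orP[]/asboolP// /Rel_sym.
apply/andP; split; last by apply/orP; left; apply/asboolP.
by apply/eqP => e; rewrite e in uv; apply: Rel_irr uv.
Qed.

(** A neighbour outside the image would give a one-point extension in which the image is not
    closed. *)
Lemma closed_embedding_nbr (A : fgraph) (f : A -> M) u b :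
  closed_embedding f -> Rel (f u) b -> exists v, b = f v.
Proof.
move=> [[finj fe] cl] ub; apply: contrapT => nb.
(* [None] stands for the supposed new point [b]. *)
pose g (o : option A) := if o is Some a then f a else b.
have ginj : injective g.
  move=> [x|] [y|] //=; first by move/finj->.
    by move=> e; case: nb; exists x.
  by move=> e; case: nb; exists y.
have gemb := induced_embedding ginj.
have [_ /(_ (Some u) None)[_ /(_ ub) un]] := gemb.
apply: (@edge_not_closed (induced g) [set Some a | a in [set: A]] _ _ _ _ un).
- exact: imset_f.
- by apply/imsetP => -[].
- exact: (cl (induced g) g Some gemb (fun=> erefl)).
Qed.

(** * The local game and its basic properties *)

Implicit Types (p q : M -> M -> Prop) (S T : M -> Prop).

Definition flip p : M -> M -> Prop := fun x y => p y x.
Definition dom p : M -> Prop := fun x => exists y, p x y.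
Definition add p a a' : M -> M -> Prop := fun x y => p x y \/ x = a /\ y = a'.
Definition union p q : M -> M -> Prop := fun x y => p x y \/ q x y.

Definition partial_iso p : Prop :=
  forall x x' y y', p x x' -> p y y' ->
    (x = y <-> x' = y') /\ (Rel x y <-> Rel x' y').

(* The Ehrenfeucht-Fraisse game of length k in which Spoiler must play a neighbour
   of a point already played. *)
Fixpoint local_equiv k p : Prop :=
  partial_iso p /\
  if k is k'.+1 then
    (forall a a' b, p a a' -> Rel a b ->
       exists b', local_equiv k' (add p b b')) /\
    (forall a a' b', p a a' -> Rel a' b' ->
       exists b, local_equiv k' (add p b b'))
  else True.

Lemma local_equiv_iso k p : local_equiv k p -> partial_iso p.
Proof. by case: k => [|k] []. Qed.

(** With fewer pairs, Spoiler has fewer points to move from and Duplicator fewer conditions to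
    respect. *)
Lemma local_equiv_sub k p q :
  (forall x y, q x y -> p x y) -> local_equiv k p -> local_equiv k q.
Proof.
elim: k p q => [|k IH] p q qp [ip]; first by split=> // x x' y y' /qp ? /qp; apply: ip.
move=> [fp bp]; split; first by move=> x x' y y' /qp ? /qp; apply: ip.
have qp' b b' x y : add q b b' x y -> add p b b' x y by case=> [/qp|]; [left|right].
split=> a a' b /qp aa' ab.
  by have [b' gb] := fp _ _ _ aa' ab; exists b'; apply: IH gb; apply: qp'.
by have [b' gb] := bp _ _ _ aa' ab; exists b'; apply: IH gb; apply: qp'.
Qed.

Lemma local_equivS k p : local_equiv k.+1 p -> local_equiv k p.
Proof.
elim: k p => [|k IH] p [ip [fp bp]]; split=> //; split=> a a' b aa' ab.
  by have [b' /IH] := fp _ _ _ aa' ab; exists b'.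
by have [b' /IH] := bp _ _ _ aa' ab; exists b'.
Qed.

Lemma local_equiv_le j k p : j <= k -> local_equiv k p -> local_equiv j p.
Proof.
by move/subnK<-; elim: (k - j) => [|m IH] //; rewrite addSn => /local_equivS.
Qed.

Lemma local_equiv_flip k p : local_equiv k p -> local_equiv k (flip p).
Proof.
elim: k p => [|k IH] p [ip]; have ip' : partial_iso (flip p).
- by move=> x x' y y' xx yy; have [e r] := ip _ _ _ _ xx yy; split; apply: iff_sym.
- by [].
- by move=> x x' y y' xx yy; have [e r] := ip _ _ _ _ xx yy; split; apply: iff_sym.
have addf b b' x y : add (flip p) b b' x y -> flip (add p b' b) x y.
  by case=> [|[-> ->]]; [left|right].
move=> [fp bp]; split=> //; split=> a a' b aa' ab.
  have [b' /IH gb] := bp _ _ _ aa' ab; exists b'; apply: local_equiv_sub gb; exact: addf.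
have [b' /IH gb] := fp _ _ _ aa' ab; exists b'; apply: local_equiv_sub gb; exact: addf.
Qed.

(** * Balls, separation and combination of strategies *)

Fixpoint ball n S (y : M) : Prop :=
  if n is n'.+1 then ball n' S y \/ exists2 z, ball n' S z & Rel z y else S y.

(** Equivalently, [S] and [T] are at distance greater than 2n+1. *)
Definition separated n S T : Prop :=
  forall x y, ball n S x -> ball n T y -> x <> y /\ ~ Rel x y.

Lemma ball_sub n S T y : (forall x, S x -> T x) -> ball n S y -> ball n T y.
Proof.
move=> ST; elim: n y => [|n IH] y /=; first exact: ST.
by case=> [/IH|[z /IH ? ?]]; [left|right; exists z].
Qed.

Lemma ball_le m n S y : m <= n -> ball m S y -> ball n S y.
Proof. by move/subnK<-; elim: (n - m) => [|j IH] // Sy; left; apply: IH. Qed.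

Lemma ball_closed n S T y :
  (forall x z, T x -> Rel x z -> T z) -> (forall x, S x -> T x) ->
  ball n S y -> T y.
Proof.
move=> cl ST; elim: n y => [|n IH] y /=; first exact: ST.
by case=> [/IH//|[z /IH Tz /(cl _ _ Tz)]].
Qed.

(** Reversing the walk from [a] to [y], edge by edge, leads from [y] back to [a]. *)
Lemma ball_return m n S a y : ball n (eq a) y -> ball m S y -> ball (m + n) S a.
Proof.
elim: n m y => [|n IH] m y /=; first by rewrite addn0 => <-.
case=> [ay Sy|[z az zy] Sy]; first by apply: ball_le (IH _ _ ay Sy); lia.
by rewrite -addSnnS; apply: IH az _; right; exists y => //; apply: Rel_sym.
Qed.

Lemma separated_sym n S T : separated n S T -> separated n T S.
Proof.
move=> sp x y Tx Sy; have [ne nr] := sp _ _ Sy Tx.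
by split=> [e|/Rel_sym//]; apply: ne.
Qed.

Lemma separated_sub n S S' T T' :
  (forall x, S' x -> S x) -> (forall x, T' x -> T x) ->
  separated n S T -> separated n S' T'.
Proof. by move=> SS TT sp x y /(ball_sub SS) Sx /(ball_sub TT); apply: sp. Qed.

Lemma separated_le m n S T : m <= n -> separated n S T -> separated m S T.
Proof. by move=> mn sp x y /(ball_le mn) Sx /(ball_le mn); apply: sp. Qed.

Lemma separated_ball n S S' T :
  (forall x, S' x -> ball 1 S x) -> separated n.+1 S T -> separated n S' T.
Proof.
move=> SS sp x y Sx Ty; apply: sp; last by left.
elim: n x Sx {Ty} => [|n IH] x; first exact: SS.
case=> [Sx|[z Sz zx]]; first by left; apply: IH.
by right; exists z => //; apply: IH.
Qed.

(** Duplicator answers each move by the strategy of the side on which it is played. A move goes to a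
    neighbour, so it lowers the radius of separation by at most one; after [k] rounds points of
    different sides are still distinct and non-adjacent. *)
Lemma local_equiv_union k p q :
  local_equiv k p -> local_equiv k q ->
  separated k (dom p) (dom q) -> separated k (dom (flip p)) (dom (flip q)) ->
  local_equiv k (union p q).
Proof.
elim: k p q => [|k IH] p q gp gq sd sc.
  have [ip iq] := (local_equiv_iso gp, local_equiv_iso gq); split=> //.
  have cross x x' y y' : p x x' -> q y y' ->
      [/\ x <> y, x' <> y', ~ Rel x y & ~ Rel x' y'].
    move=> xx yy; have [? ?] : x <> y /\ ~ Rel x y by apply: sd; [exists x'|exists y'].
    by have [? ?] : x' <> y' /\ ~ Rel x' y' by apply: sc; [exists x|exists y].
  move=> x x' y y' [px|qx] [py|qy]; [exact: ip| | |exact: iq].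
    by have [? ? ? ?] := cross _ _ _ _ px qy.
  have [n1 n2 r1 r2] := cross _ _ _ _ py qx.
  by split; split=> [e|e]; [case: n1|case: n2|case: r1; apply: Rel_sym|
                            case: r2; apply: Rel_sym].
have iso : partial_iso (union p q).
  apply: (@local_equiv_iso k); apply: IH; first exact: local_equivS.
  - exact: local_equivS.
  - exact: separated_le sd.
  - exact: separated_le sc.
(* One statement covers moves on either side and in either coordinate; the isomorphism condition in
   [gb] turns an edge in one coordinate into an edge in the other. *)
have step p1 q1 a a' b b' : local_equiv k q1 ->
    separated k.+1 (dom p1) (dom q1) ->
    separated k.+1 (dom (flip p1)) (dom (flip q1)) ->
    p1 a a' -> (Rel a b \/ Rel a' b') -> local_equiv k (add p1 b b') ->
    local_equiv k (union (add p1 b b') q1).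
  move=> gq1 sd1 sc1 aa ab gb.
  have [_ r] : (a = b <-> a' = b') /\ (Rel a b <-> Rel a' b').
    by apply: (local_equiv_iso gb); [left|right].
  apply: IH => //.
    apply: separated_ball sd1 => x [y [xy|[-> _]]]; first by left; exists y.
    by right; exists a; [exists a'|case: ab => // /r].
  apply: separated_ball sc1 => x [y [xy|[_ ->]]]; first by left; exists y.
  by right; exists a'; [exists a|case: ab => // /r].
have [[_ [fp bp]] [_ [fq bq]]] := (gp, gq).
have [lp lq] := (local_equivS gp, local_equivS gq).
have [sd' sc'] := (separated_sym sd, separated_sym sc).
split=> //; split=> [a a' b|a a' b'] [aa|aa] ab.
- have [b' gb] := fp _ _ _ aa ab; exists b'.
  apply: local_equiv_sub (step p q a a' _ _ lq sd sc aa (or_introl ab) gb) => x y.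
  by case=> [[?|?]|?]; [left; left|right|left; right].
- have [b' gb] := fq _ _ _ aa ab; exists b'.
  apply: local_equiv_sub (step q p a a' _ _ lp sd' sc' aa (or_introl ab) gb) => x y.
  by case=> [[?|?]|?]; [right|left; left|left; right].
- have [b gb] := bp _ _ _ aa ab; exists b.
  apply: local_equiv_sub (step p q a a' _ _ lq sd sc aa (or_intror ab) gb) => x y.
  by case=> [[?|?]|?]; [left; left|right|left; right].
- have [b gb] := bq _ _ _ aa ab; exists b.
  apply: local_equiv_sub (step q p a a' _ _ lp sd' sc' aa (or_intror ab) gb) => x y.
  by case=> [[?|?]|?]; [right|left; left|left; right].
Qed.

(** Spoiler may spend [n] rounds walking from [dom p] to [a]; the answer to the last step is [a'],
    and the intermediate points are forgotten. *)
Lemma local_equiv_ball n k p a :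
  local_equiv (n + k) p -> ball n (dom p) a ->
  exists a', local_equiv k (add p a a').
Proof.
elim: n k p a => [|n IH] k p a gp /=.
  case=> a' aa; exists a'; apply: local_equiv_sub gp => x y.
  by case=> // -[-> ->].
case=> [pa|[z pz za]]; first by apply: IH pa; apply: local_equivS.
have [|z' [_ [fz _]]] := IH k.+1 p z _ pz; first by rewrite addnS.
have [|a' ga] := fz z z' a _ za; first by right.
by exists a'; apply: local_equiv_sub ga => x y [?|?]; [left; left|right].
Qed.

(** Duplicator can always answer with a pair already in [p], so the game never grows. *)
Lemma local_equiv_bisim p k :
  partial_iso p ->
  (forall a a' b, p a a' -> Rel a b -> exists b', p b b') ->
  (forall a a' b', p a a' -> Rel a' b' -> exists b, p b b') ->
  local_equiv k p.
Proof.
move=> ip fp bp; elim: k => [|k IH]; split=> //; split=> a a' b aa ab.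
  have [b' bb] := fp _ _ _ aa ab; exists b'; apply: local_equiv_sub IH => x y.
  by case=> // -[-> ->].
have [b' bb] := bp _ _ _ aa ab; exists b'; apply: local_equiv_sub IH => x y.
by case=> // -[-> ->].
Qed.

(* a' is the image of a in a copy of the component of a that misses the
   components of the points s; the copy comes from the free amalgam. *)
Lemma distant_copy (T : finType) (s : T -> M) (a : M) :
  exists a', forall k,
    local_equiv k (add (fun _ _ => False) a a') /\
    separated k (fun x => exists t, x = s t) (eq a').
Proof.
have [A [f [KA cf /(_ tt)[u0 fu0]]]] := closed_cover (fun _ : unit => a).
have [D [d [KD cd sd]]] := closed_cover s.
(* [D] is closed in the sum, so the extension property realises the sum over it and yields a copy of
   [A] apart from all the points [s t]. *)
have [|g [cg gd]] := @generic_extension _ _ hM D (sum_graph D A) d (@sum_inl D A)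
                      cd (K_sum KD KA) (sum_inl_emb D A).
  exact: sum_inl_closed_in (K_K_omega KA).
have [[finj fe] [[ginj ge] _]] := (cf.1, cg).
have gnbr u b : Rel (g u) b -> exists2 v, b = g v & edge u v.
  move=> ub; have [v ev] := closed_embedding_nbr cg ub; subst b.
  by exists v => //; apply/ge.
(* The image of [g] is closed under neighbours, so a set of vertices closed under edges maps onto a
   set that balls never leave. *)
have leave (h : sum_graph D A -> bool) :
    (forall u v, edge u v -> h u -> h v) ->
    forall n S y, (forall x, S x -> exists2 u, h u & x = g u) -> ball n S y ->
    exists2 u, h u & y = g u.
  move=> hcl n S y Sh.
  apply: (@ball_closed n S (fun y => exists2 u, h u & y = g u)) => //.
  by move=> x z [u hu ->] /gnbr[v -> /hcl/(_ hu)]; exists v.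
exists (g (inr u0)) => k; split.
  (* The single pair is enlarged to the isomorphism between the image of [A] and its copy. Both are
     unions of components, so it serves for any number of rounds. *)
  apply: (@local_equiv_sub _ (fun x y => exists2 u, x = f u & y = g (inr u))).
    by move=> x y [//|[-> ->]]; exists u0.
  apply: local_equiv_bisim => [x x' y y' [u -> ->] [v -> ->]|x x' y [u -> _]|].
  - split; split.
    + by move/finj->.
    + by move/ginj=> [->].
    + by move/fe=> uv; apply/ge.
    + by move/ge=> uv; apply/fe.
  - by move=> uy; have [v ->] := closed_embedding_nbr cf uy; exists (g (inr v)), v.
  - by move=> x x' y [u _ ->] /gnbr[[v|v] -> //] _; exists (f v), v.
move=> x y sx ay.
have [[u|//] _ ->] : exists2 u : sum_graph D A, is_inl u & x = g u.
  apply: leave sx => [[?|?] [?|?]//|z [t ->]].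
  by have [c ec] := sd t; exists (inl c) => //; rewrite -ec -gd.
have [[//|v] _ ->] : exists2 u : sum_graph D A, ~~ is_inl u & y = g u.
  by apply: leave ay => [[?|?] [?|?]//|z <-]; exists (inr u0).
by split=> [/ginj|/ge].
Qed.

(** * Satisfaction depends only on the local game *)

Definition pairs (e e' : nat -> M) (V : seq nat) : M -> M -> Prop :=
  fun x y => exists v, [/\ v \in V, x = e v & y = e' v].

(** This answers an unrestricted move. If [a] is within distance 2k+1 of the parameters, 2k+1 rounds
    walk to it and [k] remain; otherwise a distant copy is taken and the two strategies are
    combined. *)
Lemma local_equiv_extend k V (e e' : nat -> M) a :
  local_equiv (k + k + k).+1 (pairs e e' V) ->
  exists a', local_equiv k (add (pairs e e' V) a a').
Proof.
set p := pairs e e' V => gp.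
have [sp|] := pselect (separated k (dom p) (eq a)); last first.
  move=> nsp; apply: (@local_equiv_ball (k + k).+1); first by rewrite addSn.
  (* Balls of radius [k] that meet put [a] at distance at most 2k; balls joined by an edge, at most
     2k+1. *)
  apply: contrapT => far; apply: nsp => x y px ay; split=> [exy|xy]; apply: far.
    by left; apply: ball_return ay _; rewrite -exy.
  by rewrite -addSn; apply: ball_return ay _; right; exists x.
have [a' /(_ k)[ga sa]] := distant_copy (fun i : seq_sub V => e' (val i)) a.
exists a'; have gp' : local_equiv k p by apply: local_equiv_le gp; lia.
apply: local_equiv_sub (local_equiv_union gp' ga _ _).
- by move=> x y [?|?]; [left|right; right].
- by apply: separated_sub sp => // x [y [//|[-> _]]].
- apply: separated_sub sa => [x [y [v [vV _ ->]]]|x [y [//|[_ ->]]]] //.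
  by exists (SeqSub vV).
Qed.

(** Induction on [phi], a quantifier taking [k] to 3k+1. Preservation in one direction suffices,
    since the game is symmetric in [e] and [e']. *)
Lemma sat_local phi : exists k, forall e e' : nat -> M,
  local_equiv k (pairs e e' (fv phi)) -> sat e phi -> sat e' phi.
Proof.
have pairs_flip k e e' V : local_equiv k (pairs e e' V) -> local_equiv k (pairs e' e V).
  by move/local_equiv_flip; apply: local_equiv_sub => x y [v [? ? ?]]; exists v.
have pairs_sub k e e' V W : {subset W <= V} ->
    local_equiv k (pairs e e' V) -> local_equiv k (pairs e e' W).
  by move=> WV; apply: local_equiv_sub => x y [v [/WV ? ? ?]]; exists v.
have bin f g : (exists k, forall e e', local_equiv k (pairs e e' (fv f)) ->
      sat e f -> sat e' f) -> (exists k, forall e e',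
      local_equiv k (pairs e e' (fv g)) -> sat e g -> sat e' g) ->
    exists k, forall e e', local_equiv k (pairs e e' (fv f ++ fv g)) ->
      (sat e f <-> sat e' f) /\ (sat e g <-> sat e' g).
  move=> [k1 h1] [k2 h2]; exists (maxn k1 k2) => e e' gk.
  have g1 : local_equiv k1 (pairs e e' (fv f)).
    apply: local_equiv_le (leq_maxl k1 k2) _; apply: pairs_sub gk => v.
    by rewrite mem_cat => ->.
  have g2 : local_equiv k2 (pairs e e' (fv g)).
    apply: local_equiv_le (leq_maxr k1 k2) _; apply: pairs_sub gk => v.
    by rewrite mem_cat orbC => ->.
  by split; split; [apply: h1|apply/h1/pairs_flip|apply: h2|apply/h2/pairs_flip].
have quant i f k e e' a : local_equiv (k + k + k).+1
      (pairs e e' [seq j <- fv f | j != i]) ->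
    exists a', local_equiv k (pairs (update e i a) (update e' i a') (fv f)).
  move=> /(@local_equiv_extend _ _ _ _ a)[a' ga]; exists a'.
  apply: local_equiv_sub ga => x y [v [vf -> ->]]; rewrite /update.
  by have [_|vi] := eqVneq v i; [right|left; exists v; rewrite mem_filter vi].
elim: phi => [|i j|i j|f [k IH]|f Hf g Hg|f Hf g Hg|f Hf g Hg|i f [k IH]|i f [k IH]] /=.
- by exists 0.
- exists 0 => e e' [iso _].
  have [||[h _] _ //] := iso (e i) (e' i) (e j) (e' j).
    by exists i; rewrite inE eqxx.
  by exists j; rewrite !inE eqxx orbT.
- exists 0 => e e' [iso _].
  have [||_ [h _] //] := iso (e i) (e' i) (e j) (e' j).
    by exists i; rewrite inE eqxx.
  by exists j; rewrite !inE eqxx orbT.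
- by exists k => e e' /pairs_flip/IH; tauto.
- by have [k h] := bin _ _ Hf Hg; exists k => e e' /h; tauto.
- by have [k h] := bin _ _ Hf Hg; exists k => e e' /h; tauto.
- by have [k h] := bin _ _ Hf Hg; exists k => e e' /h; tauto.
- exists (k + k + k).+1 => e e' ge [a fa].
  by have [a' /IH/(_ fa)] := quant _ _ _ _ _ a ge; exists a'.
- exists (k + k + k).+1 => e e' /pairs_flip ge fa a'.
  by have [a /pairs_flip/IH] := quant _ _ _ _ _ a' ge; apply.
Qed.

(** * Finite conjunctions and diagrams *)

Lemma sat_FAnds (T : eqType) (s : seq T) (F : T -> formula) (e : nat -> M) :
  sat e (FAnds (map F s)) <-> forall t, t \in s -> sat e (F t).
Proof.
elim: s => [|t s [IH1 IH2]] //=; split=> [[Ft /IH1 Fs] u|Fs].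
  by rewrite inE => /predU1P[->|/Fs].
split; first by apply: Fs; rewrite mem_head.
by apply: IH2 => u us; apply: Fs; rewrite inE us orbT.
Qed.

Lemma sat_FAnds_fin (I : finType) (F : I -> formula) (e : nat -> M) :
  sat e (FAnds [seq F i | i <- enum I]) <-> forall i, sat e (F i).
Proof.
by split=> [/sat_FAnds h i|h]; [apply: h; rewrite mem_enum|apply/sat_FAnds].
Qed.

Lemma fv_FAnds_fin (I : finType) (F : I -> formula) (V : seq nat) :
  (forall i, {subset fv (F i) <= V}) ->
  {subset fv (FAnds [seq F i | i <- enum I]) <= V}.
Proof.
move=> h; elim: (enum I) => //= i s IH v; rewrite mem_cat.
by case/orP => [/h|/IH].
Qed.

Definition diag_atom (G : fgraph) (x : G -> nat) (uv : G * G) : formula :=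
  FAnd (if uv.1 == uv.2 then FEq (x uv.1) (x uv.2)
        else FNot (FEq (x uv.1) (x uv.2)))
       (if edge uv.1 uv.2 then FRel (x uv.1) (x uv.2)
        else FNot (FRel (x uv.1) (x uv.2))).

Lemma diagE (G : fgraph) (x : G -> nat) :
  diag x = FAnds [seq diag_atom x uv | uv <- [seq (u, v) | u <- enum G, v <- enum G]].
Proof. by rewrite map_allpairs. Qed.

Lemma sat_diag (G : fgraph) (x : G -> nat) (e : nat -> M) :
  sat e (diag x) <-> @fembedding G M (fun u => e (x u)).
Proof.
rewrite diagE; split.
  move/sat_FAnds => h; have {h} h u v : sat e (diag_atom x (u, v)).
    by apply: h; apply: allpairs_f; rewrite mem_enum.
  split=> u v; have := h u v; rewrite /diag_atom /=.
    by case: eqP => //= _ [].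
  by move=> [_]; case: (edge u v).
move=> [inj emb]; apply/sat_FAnds => -[u v] _; rewrite /diag_atom /=; split.
  by case: eqP => [->//|nuv] /=; move/inj.
by have [h1 h2] := emb u v; case: ifPn => [/h1//|nuv /= /h2]; apply/negP.
Qed.

Lemma fv_diag (G : fgraph) (x : G -> nat) : {subset fv (diag x) <= codom x}.
Proof.
rewrite diagE; elim: [seq _ | _ <- _, _ <- _] => //= -[a b] s IH v.
rewrite !mem_cat => /orP[|/IH//].
by case: eqP; case: ifP => _ _ /=; rewrite !inE => /orP[] /orP[]/eqP->; apply: codom_f.
Qed.

(** [FTrue] is the diagram of the empty graph, which embeds in [M] and so lies in the class. *)
Lemma closure_FTrue : closure_formula alpha FTrue.
Proof.
pose G := set_graph (set0 : {set void * void}).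
pose x (v : G) : nat := match (v : void) with end.
suff <- : diag x = FTrue.
  apply: CF_diag => [|[]]; apply: (@K_induced _ (fun v : G => match (v : void) with end)).
  by split=> [[]|[]].
rewrite diagE.
by have -> : enum G = [::] by apply/size0nil; rewrite -cardE card_void.
Qed.

Lemma closure_FAnds (I : finType) (F : I -> formula) :
  (forall i, closure_formula alpha (F i)) ->
  closure_formula alpha (FAnds [seq F i | i <- enum I]).
Proof.
move=> h; elim: (enum I) => /= [|i s IH]; first exact: closure_FTrue.
exact: CF_and.
Qed.

(** * Relations implied by agreement on finitely many closure formulas *)

Definition determined (V : seq nat) (E : (nat -> M) -> (nat -> M) -> Prop) : Prop :=
  exists (I : finType) (F : I -> formula),
    (forall i, closure_formula alpha (F i) /\ {subset fv (F i) <= V}) /\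
    forall e e', (forall i, sat e (F i) <-> sat e' (F i)) -> E e e'.

Lemma determined_true V (E : (nat -> M) -> (nat -> M) -> Prop) :
  (forall e e', E e e') -> determined V E.
Proof. by move=> h; exists void, (@of_void _); split=> [[]|e e' _]. Qed.

Lemma determined_imp V (P : Prop) (E : (nat -> M) -> (nat -> M) -> Prop) :
  (P -> determined V E) -> determined V (fun e e' => P -> E e e').
Proof.
move=> h; have [p|np] := pselect P; last exact: determined_true.
by have [I [F [cF FE]]] := h p; exists I, F; split=> // e e' /FE.
Qed.

Lemma determined_flip V E :
  determined V E -> determined V (fun e e' => E e' e).
Proof.
move=> [I [F [cF FE]]]; exists I, F; split=> // e e' h; apply: FE => i.
exact: iff_sym.
Qed.

Lemma determined_sub V (E E' : (nat -> M) -> (nat -> M) -> Prop) :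
  (forall e e', E e e' -> E' e e') -> determined V E -> determined V E'.
Proof.
by move=> EE [I [F [cF FE]]]; exists I, F; split=> // e e' /FE/EE.
Qed.

(** The families for the finitely many [j] are merged into one, indexed by a dependent sum. *)
Lemma determined_forall V (J : finType) (E : J -> (nat -> M) -> (nat -> M) -> Prop) :
  (forall j, determined V (E j)) -> determined V (fun e e' => forall j, E j e e').
Proof.
move=> dE; have /choice[X hX] j : exists X : {I : finType & I -> formula},
    (forall i, closure_formula alpha (tagged X i) /\ {subset fv (tagged X i) <= V}) /\
    forall e e', (forall i, sat e (tagged X i) <-> sat e' (tagged X i)) -> E j e e'.
  by have [I [F FE]] := dE j; exists (Tagged (fun I : finType => I -> formula) F).
exists {j : J & tag (X j)}, (fun i => tagged (X (tag i)) (tagged i)).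
split=> [i|e e' h j]; first by have [cF _] := hX (tag i); apply: cF.
have [_ FE] := hX j; apply: FE => i.
exact: (h (Tagged (fun j : J => tag (X j)) i)).
Qed.

Lemma determined_and V E1 E2 : determined V E1 -> determined V E2 ->
  determined V (fun e e' => E1 e e' /\ E2 e e').
Proof.
move=> h1 h2; apply: determined_sub (determined_forall (E := fun b : bool =>
  if b then E1 else E2) _); last by case.
by move=> e e' h; split; [apply: (h true)|apply: (h false)].
Qed.

Section Types.
Variables (I : finType) (F : I -> formula).

(** The complete type over [F] in which exactly the formulas of [S] are true. *)
Definition type_formula (S : {set I}) : formula :=
  FAnds [seq if i \in S then F i else FNot (F i) | i <- enum I].

Lemma sat_type_formula (S : {set I}) (e : nat -> M) :
  sat e (type_formula S) <-> forall i, sat e (F i) <-> i \in S.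
Proof.
rewrite sat_FAnds_fin; split=> h i; have := h i.
  by case: ifP => // _ nF.
by case: ifP => _ [h1 h2]; [apply: h2|move/h1].
Qed.

Lemma sat_type_of (e : nat -> M) : sat e (type_formula [set i | `[< sat e (F i) >]]).
Proof. by apply/sat_type_formula => i; rewrite inE; split=> /asboolP. Qed.

Lemma closure_type_formula (S : {set I}) :
  (forall i, closure_formula alpha (F i)) -> closure_formula alpha (type_formula S).
Proof. by move=> h; apply: closure_FAnds => i; case: ifP => _; [|apply: CF_not]. Qed.

Lemma fv_type_formula (S : {set I}) (V : seq nat) :
  (forall i, {subset fv (F i) <= V}) -> {subset fv (type_formula S) <= V}.
Proof. by move=> h; apply: fv_FAnds_fin => i; case: ifP => _; apply: h. Qed.

End Types.

(** [P] is a union of classes of agreement on [F], and there are finitely many of these. The formula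
    is the disjunction of the types realised in [P], written with [FNot] and [FAnds] by De
    Morgan. *)
Lemma determined_definable V (P : (nat -> M) -> Prop) :
  determined V (fun e e' => P e -> P e') ->
  exists psi, [/\ closure_formula alpha psi, {subset fv psi <= V} &
                  forall e, sat e psi <-> P e].
Proof.
move=> [I [F [cF FP]]].
have cT (S : {set I}) : closure_formula alpha (type_formula F S).
  by apply: closure_type_formula => i; case: (cF i).
pose Q (S : {set I}) := exists2 e, sat e (type_formula F S) & P e.
pose H (S : {set I}) := if `[< Q S >] then FNot (type_formula F S) else FTrue.
exists (FNot (FAnds [seq H X | X <- enum {set I}])); split.
- apply: CF_not; apply: closure_FAnds => S; rewrite /H; case: ifP => _.
    exact: CF_not.
  exact: closure_FTrue.
- apply: (@fv_FAnds_fin _ H) => S; rewrite /H; case: ifP => // _.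
  by apply: fv_type_formula => i; case: (cF i).
move=> e; split=> [|Pe].
  apply: contra_notP => nP; apply/sat_FAnds_fin => S; rewrite /H.
  case: ifP => // /asboolP[e0 S0 P0] /= Se; apply: nP; apply: FP P0 => i.
  by rewrite (sat_type_formula F S e0).1 // (sat_type_formula F S e).1.
move=> /sat_FAnds_fin/(_ [set i | `[< sat e (F i) >]]); rewrite /H asboolT.
  by apply; apply: sat_type_of.
by exists e => //; apply: sat_type_of.
Qed.

(** * Closure formulas describe the local game *)

Lemma codom_val (U : seq nat) : codom (val : seq_sub U -> nat) =i U.
Proof.
move=> v; apply/codomP/idP => [[u ->]|vU]; first exact: valP.
by exists (SeqSub vU).
Qed.

(** The diagram of a graph outside the class is never satisfied in [M], so the implication is then
    vacuous. *)
Lemma determined_diag V (U : seq nat) (E : {set seq_sub U * seq_sub U}) :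
  {subset U <= V} ->
  determined V (fun e e' => sat e (@diag (set_graph E) val) ->
                            sat e' (@diag (set_graph E) val)).
Proof.
move=> UV; have [KE|nK] := pselect (K alpha (set_graph E)).
  exists unit, (fun _ => @diag (set_graph E) val); split=> [_|e e' /(_ tt)[]//].
  split; first by apply: CF_diag => //; apply: val_inj.
  by move=> v /fv_diag; rewrite codom_val => /UV.
by apply: determined_true => e e' /sat_diag/K_induced.
Qed.

(** A diagram forces distinct values at distinct vertices, so two values are equal when every
    diagram on the two variables fails. Agreement on these diagrams settles equality as well as
    adjacency. *)
Lemma determined_iso V : determined V (fun e e' => partial_iso (pairs e e' V)).
Proof.
pose E0 (uv : seq_sub V * seq_sub V) (E : {set _ * _}) (e e' : nat -> M) :=
  let U := [:: val uv.1; val uv.2] in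
  sat e (@diag (@set_graph (seq_sub U) E) val) ->
  sat e' (@diag (@set_graph (seq_sub U) E) val).
pose E1 e e' := forall uv E, E0 uv E e e'.
have det : determined V (fun e e' => E1 e e' /\ E1 e' e).
  have d : determined V E1.
    apply: determined_forall => uv; apply: determined_forall => E.
    by apply: determined_diag => v; rewrite !inE => /orP[]/eqP->; apply: valP.
  by apply: (determined_and d); apply: determined_flip d.
apply: determined_sub det => e e' [h h'].
have ne e1 e2 v w : E1 e1 e2 -> v \in V -> w \in V -> e1 v <> e1 w ->
    e2 v <> e2 w /\ (Rel (e1 v) (e1 w) <-> Rel (e2 v) (e2 w)).
  move=> E12 vV wV nvw; set U := [:: v; w].
  pose g (u : seq_sub U) := e1 (val u).
  have vU : v \in U by rewrite mem_head.
  have wU : w \in U by rewrite !inE eqxx orbT.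
  have ginj : injective g.
    move=> [a aU] [b bU]; rewrite /g /= => eab; apply: val_inj => /=.
    move: aU bU eab; rewrite !inE => /orP[]/eqP-> /orP[]/eqP-> // eab.
    by case: nvw.
  have [_ g1] := induced_embedding ginj.
  have /sat_diag := induced_embedding ginj.
  move/(E12 (SeqSub vV, SeqSub wV)) => /sat_diag[inj2 g2].
  split; last by apply: iff_trans (iff_sym (g1 (SeqSub vU) (SeqSub wU))) (g2 _ _).
  move=> e2vw; case: nvw; have := inj2 (SeqSub vU) (SeqSub wU) e2vw.
  by move/(congr1 val) => /= ->.
move=> _ _ _ _ [v [vV -> ->]] [w [wV -> ->]].
have [evw|nvw] := pselect (e v = e w).
  have evw' : e' v = e' w by apply: contrapT => /(ne _ _ _ _ h' vV wV)[].
  by rewrite evw evw'; split=> //; split=> /Rel_irr.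
by have [nvw' r] := ne _ _ _ _ h vV wV nvw.
Qed.

(** Diagrams require distinct values, so one variable is kept for each value. *)
Lemma injective_subseq (e : nat -> M) V : exists W, [/\ subseq W V,
  {in W &, injective e} & forall v, v \in V -> exists2 w, w \in W & e v = e w].
Proof.
elim: V => [|v V [W [sW iW cW]]]; first by exists [::].
have [[w wW ew]|nw] := pselect (exists2 w, w \in W & e v = e w).
  exists W; split=> //; first exact: subseq_trans sW (subseq_cons _ _).
  by move=> u /predU1P[->|/cW//]; exists w.
exists (v :: W); split; first by rewrite /= eqxx.
  move=> a b; rewrite !inE => /predU1P[->|aW] /predU1P[->|bW] // eab.
  - by case: nw; exists b.
  - by case: nw; exists a.
  - exact: iW.
move=> u /predU1P[->|/cW[w wW ->]]; first by exists v; rewrite ?mem_head.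
by exists w; rewrite // inE wW orbT.
Qed.

Lemma fresh_variable (V : seq nat) : exists z, z \notin V.
Proof.
exists (\max_(v <- V) v).+1; apply/negP => zV.
by have := @leq_bigmax_seq _ V predT id _ zV isT; rewrite ltnn.
Qed.

Definition witnessed k z U (E : {set seq_sub U * seq_sub U}) (e e' : nat -> M) :=
  forall b, sat (update e z b) (@diag (set_graph E) val) ->
    exists b', local_equiv k (pairs (update e z b) (update e' z b') U).

(** The formulas say that some [z] completes the diagram and has a prescribed type over the family
    [F] for [k] rounds. An answer [b'] of the same type as [b] then leaves Duplicator [k] rounds. *)
Lemma determined_witnessed k z W (E : {set seq_sub (z :: W) * _}) :
  z \notin W -> determined (z :: W) (fun e e' => local_equiv k (pairs e e' (z :: W))) ->
  intrinsic [set u : set_graph E | u != SeqSub (mem_head z W)] ->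
  determined W (witnessed k z E).
Proof.
move=> zW [I [F [cF FE]]] iE; have [KE|nK] := pselect (K alpha (set_graph E)); last first.
  by apply: determined_true => e e' b /sat_diag/K_induced.
pose H (S : {set I}) := FEx z (FAnd (@diag (set_graph E) val) (type_formula F S)).
have fvT (S : {set I}) : {subset fv (type_formula F S) <= z :: W}.
  by apply: fv_type_formula => i; case: (cF i).
exists {set I}, H; split=> [S|e e' h b bE].
  split.
    apply: (@CF_ex _ _ _ _ [:: z]) iE val_inj _ _ _ => //.
    - apply: uniq_perm => //; first by rewrite map_inj_uniq ?enum_uniq //; apply: val_inj.
      move=> v; rewrite inE; apply/eqP/imageP => [->|[u]]; last first.
        by rewrite !inE negbK => /eqP -> ->.
      by exists (SeqSub (mem_head z W)); rewrite // !inE eqxx.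
    - by move=> v /fvT; rewrite codom_val.
    - by apply: closure_type_formula => i; case: (cF i).
  move=> v; rewrite /= mem_filter mem_cat => /andP[vz].
  case/orP => [/fv_diag|/fvT]; rewrite ?codom_val inE (negPf vz) //.
pose S := [set i | `[< sat (update e z b) (F i) >]].
have [[b' [_ Sb']] _] : sat e' (H S) /\ True.
  by split=> //; apply/h; exists b; split=> //; apply: sat_type_of.
exists b'; apply: FE => i.
rewrite (sat_type_formula F S _).1 //; last exact: sat_type_of.
by rewrite (sat_type_formula F S _).1.
Qed.

(** Induction on [k]. A move to a new neighbour adds a pendant point, hence an intrinsic extension,
    to which [determined_witnessed] applies. *)
Lemma determined_local k V :
  determined V (fun e e' => local_equiv k (pairs e e' V)).
Proof.
elim: k V => [|k IH] V.
  by apply: determined_sub (determined_iso V) => e e' iso.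
have [z zV] := fresh_variable V.
(* Subsequences of [V] are coded by masks so that they range over a finite type. *)
pose W (m : (size V).-tuple bool) := mask m V.
have WV m v : v \in W m -> v \in V by apply: mem_mask.
pose E1 e e' := forall m (E : {set seq_sub (z :: W m) * seq_sub (z :: W m)}),
  intrinsic [set u : set_graph E | u != SeqSub (mem_head z (W m))] ->
  witnessed k z E e e'.
have d1 : determined V E1.
  apply: determined_forall => m; apply: determined_forall => E.
  apply: determined_imp => iE.
  have [|I [F [cF FE]]] := determined_witnessed _ (IH (z :: W m)) iE.
    by apply: contra zV => /WV.
  by exists I, F; split=> // i; have [? fF] := cF i; split=> // v /fF/WV.
apply: determined_sub (determined_and (IH V)
  (determined_and d1 (determined_flip d1))) => e e' [gk [h h']].
have forth e1 e2 v b : E1 e1 e2 -> local_equiv k (pairs e1 e2 V) ->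
    v \in V -> Rel (e1 v) b -> exists b', local_equiv k (add (pairs e1 e2 V) b b').
  move=> E12 g12 vV vb.
  (* A neighbour already named by a variable is answered by the same variable. *)
  have [[w0 w0V ->]|nb] := pselect (exists2 w, w \in V & b = e1 w).
    exists (e2 w0); apply: local_equiv_sub g12 => x y [//|[-> ->]].
    by exists w0.
  have [U [/subseqP[m sm eU] iU cU]] := injective_subseq e1 V.
  have [w wU evw] := cU _ vV.
  pose t : (size V).-tuple bool := tcast sm (in_tuple m).
  have eW : W t = U by rewrite eU /W val_tcast.
  rewrite -eW in iU cU wU; clear eU eW.
  pose g (u : seq_sub (z :: W t)) := update e1 z b (val u).
  have upd (e0 : nat -> M) b0 u : u \in V -> update e0 z b0 u = e0 u.
    by move=> uV; rewrite /update; case: eqP => // uz; rewrite -uz uV in zV.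
  have updz (e0 : nat -> M) b0 : update e0 z b0 z = b0 by rewrite /update eqxx.
  have ginj : injective g.
    move=> [x xU] [y yU]; rewrite /g /= => exy; apply: val_inj => /=.
    move: xU yU exy; rewrite !inE => /predU1P[->|xU] /predU1P[->|yU] //.
    - by rewrite updz (upd _ _ _ (WV t _ yU)) => e1y; case: nb; exists y; rewrite ?(WV t).
    - by rewrite updz (upd _ _ _ (WV t _ xU)) => e1x; case: nb; exists x; rewrite ?(WV t).
    - by rewrite (upd _ _ _ (WV t _ xU)) (upd _ _ _ (WV t _ yU)); apply: iU.
  have gemb := induced_embedding ginj.
  have wzU : w \in z :: W t by rewrite inE wU orbT.
  have [|b' gb] := E12 t _ _ b ((sat_diag _ _).2 gemb).
    apply: (@intrinsic_pendant (induced g) (SeqSub wzU)).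
    by apply/(gemb.2); rewrite /g /= updz (upd _ _ _ (WV t _ wU)) -evw.
  (* A variable dropped from [V] shares its [e1]-value with a kept one; by the partial isomorphism
     they also share their [e2]-value, so the pairs over [V] are recovered. *)
  exists b'; apply: local_equiv_sub gb => x y [[u [uV -> ->]]|[-> ->]].
    have [u' u'U eu] := cU _ uV; have u'V := WV t _ u'U.
    exists u'; rewrite inE u'U orbT !upd //; split=> //.
    have [||[h2 _] _] := local_equiv_iso g12 (x := e1 u) (x' := e2 u)
                           (y := e1 u') (y' := e2 u').
    - by exists u.
    - by exists u'.
    - exact: h2.
  by exists z; rewrite mem_head !updz.
split; first exact: local_equiv_iso gk.
split=> [_ _ b [v [vV -> _]]|_ _ b' [v [vV _ ->]]]; first exact: forth.
have flip_sub : local_equiv k (pairs e' e V).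
  apply: local_equiv_sub (local_equiv_flip gk) => x y [w [? ? ?]].
  by exists w.
move=> /(forth e' e v b' h' flip_sub vV)[b gb]; exists b.
apply: local_equiv_sub (local_equiv_flip gb) => x y [[w [? ? ?]]|[? ?]].
  by left; exists w.
by right.
Qed.

Lemma elimination_in_model phi :
  exists psi, [/\ closure_formula alpha psi, {subset fv psi <= fv phi} &
                  forall e : nat -> M, sat e psi <-> sat e phi].
Proof.
have [k hk] := sat_local phi; apply: determined_definable.
by apply: determined_sub (determined_local k (fv phi)) => e e' /hk.
Qed.

End Generic.

(** * From the model to its theory *)

Lemma fv_FAlls ys phi : fv (FAlls ys phi) = [seq j <- fv phi | j \notin ys].
Proof.
elim: ys => [|y ys IH] /=; first by rewrite filter_predT.
by rewrite IH -filter_predI; apply: eq_filter => j /=; rewrite inE negb_or.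
Qed.

Lemma holds_FAlls (N : structure) ys phi :
  holds N (FAlls ys phi) <-> holds N phi.
Proof.
split; last by elim: ys => // y ys IH h e a; apply: IH.
elim: ys => // y ys IH h; apply: IH => e; have := h e (e y).
rewrite (_ : update e y (e y) = e) //; apply/funext => j.
by rewrite /update; case: eqP => // ->.
Qed.

(** The universal closure of [phi] is a sentence of [Th M], and it holds in [N] exactly when [phi]
    does. *)
Lemma Th_entails (M : structure) phi : holds M phi -> entails (Th M) phi.
Proof.
move=> hphi N /(_ (FAlls (fv phi) phi)) hN; apply/(holds_FAlls _ (fv phi)).
apply: hN; split; last exact/holds_FAlls.
rewrite fv_FAlls; apply/eqP; rewrite -(negbK (_ == _)) -has_filter.
by apply/negP => /hasP[j jf]; rewrite jf.
Qed.

Theorem theorem3p7 (alpha : option nat) (M : structure)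
  (hM : generic alpha M) (phi : formula) :
  exists psi : formula,
    [/\ closure_formula alpha psi, {subset fv psi <= fv phi} &
        equiv_mod (Th M) phi psi].
Proof.
have [psi [cpsi fpsi eqpsi]] := elimination_in_model hM phi.
exists psi; split=> //; apply: Th_entails => e.
by split=> /eqpsi.
Qed.
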